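(* Suppose that both of the following hold: (i) for every $1<p<2$ and every $f(z)=\sum_{n\geq0}a_nz^n$ in $H^p$, $$\left(\sum_{n=0}^\infty\frac{|a_n|^2}{c_{2/p}(n)}\right)^{\frac12}\leq\|f\|_{H^p};$$ (ii) for every $2<r<\infty$, the Riesz projection $P$ is a contraction from $L^r(\mathbb{T})$ to $H^q$ with $q=4(1-1/r)$, i.e. $\|Pf\|_{H^{4(1-1/r)}}\leq\|f\|_{L^r}$ for every $f\in L^r(\mathbb{T})$. Then for every $2<q<\infty$ and every analytic function $f(z)=\sum_{n\geq0}a_nz^n$ in the unit disc for which the right-hand side is finite, $$\|f\|_{H^q}\leq\left(\sum_{n=0}^\infty|a_n|^2c_{q/2}(n)\right)^{\frac12}.$$
   Context: For real $\alpha\geq1$, $c_\alpha(n):=\binom{n+\alpha-1}{n}$ is the coefficient of $z^n$ in the binomial series $\frac{1}{(1-z)^\alpha}=\sum_{n=0}^\infty c_\alpha(n)z^n$. $\mathbb{T}$ is the unit circle with normalized Lebesgue measure $\frac{d\theta}{2\pi}$, and $L^r(\mathbb{T})$ has norm taken with respect to this measure. $H^p$ ($0<p<\infty$) is the Hardy space of analytic $f$ in the unit disc with $\|f\|_{H^p}=\sup_{0<\rho<1}\left(\int_0^{2\pi}|f(\rho e^{i\theta})|^p\frac{d\theta}{2\pi}\right)^{1/p}<\infty$. The Riesz projection $P$ is the orthogonal projection from $L^2(\mathbb{T})$ to $H^2$, i.e. $Pf(z)=\sum_{n\geq0}\widehat f(n)z^n$, where $\widehat f(n)=\int_0^{2\pi}f(e^{i\theta})e^{-in\theta}\frac{d\theta}{2\pi}$.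 *)

(* Defs.v *)
From HB Require Import structures.
From mathcomp Require Import all_boot all_order all_algebra.
From mathcomp Require Export complex.
From mathcomp Require Import all_classical all_reals all_analysis.

Set Implicit Arguments.
Unset Strict Implicit.
Unset Printing Implicit Defensive.

Import Order.TTheory GRing.Theory Num.Theory.
Import numFieldNormedType.Exports.

Local Open Scope classical_set_scope.
Local Open Scope ring_scope.

(* The generalized binomial coefficient x (x - 1) ... (x - n + 1) / n!. *)
Definition gbinom {R : realType} (x : R) (n : nat) : R :=
  (\prod_(k < n) (x - k%:R)) / n`!%:R.

Definition c_coef {R : realType} (alpha : R) (n : nat) : R :=
  gbinom (n%:R + alpha - 1) n.

Lemma pi2_gt0 (R : realType) : (0 : R) < 2 * pi.
Proof. by rewrite mulr_gt0 ?pi_gt0. Qed.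

(* The normalized Lebesgue measure dt / (2 pi) of the circle, transported to
   the angular variable t in [0, 2 pi]: a function g on the circle is integrated
   as t |-> g (expi t). *)
Definition arc {R : realType} : probability (measurableTypeR R) R :=
  uniform_prob (pi2_gt0 R).

Definition expi {R : realType} (t : R) : R[i] := (cos t +i* sin t)%C.

(* The modulus as an element of R; the generic norm `|z| takes values in R[i]. *)
Definition cabs {R : realType} (z : R[i]) : R := Normc.normc z.

(* R[i]^o is R[i] with the topology of its modulus. *)
Definition power_series {R : realType} (a : nat -> R[i]) (z : R[i]) :
    nat -> R[i]^o :=
  series (fun n => a n * z ^+ n).

(* f(z) = sum_n a_n z^n for all z in the unit disc; in particular f is analytic
   there. The values of f outside the disc are irrelevant. *)
Definition disc_expansion {R : realType} (f : R[i] -> R[i])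
    (a : nat -> R[i]) : Prop :=
  forall z : R[i], cabs z < 1 -> power_series a z @ \oo --> (f z : R[i]^o).

(* The norm of L^r of the circle; only the values of f on the circle matter. *)
Definition circle_norm {R : realType} (r : R) (f : R[i] -> R[i]) : \bar R :=
  'N[arc]_r%:E[(fun t : R => (cabs (f (expi t)))%:E)]%E.

Definition hardy_norm {R : realType} (p : R) (f : R[i] -> R[i]) : \bar R :=
  ereal_sup [set circle_norm p (fun z => f (rho%:C%C * z))
            | rho in [set rho : R | 0 < rho < 1]].

Definition hardy_space {R : realType} (p : R) : set (R[i] -> R[i]) :=
  [set f | (exists a, disc_expansion f a) /\ (hardy_norm p f < +oo)%E].

Definition circle_Lspace {R : realType} (r : R) : set (R[i] -> R[i]) :=
  [set f | [/\ measurable_fun [set: R] (fun t : R => complex.Re (f (expi t))),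
               measurable_fun [set: R] (fun t : R => complex.Im (f (expi t))) &
               (circle_norm r f < +oo)%E]].

Definition fourier {R : realType} (f : R[i] -> R[i]) (n : nat) : R[i] :=
  let g t := f (expi t) * expi (- (n%:R * t)) in
  ((\int[arc]_t complex.Re (g t)) +i* (\int[arc]_t complex.Im (g t)))%C.

Definition riesz {R : realType} (f : R[i] -> R[i]) : R[i] -> R[i] :=
  fun z => lim (power_series (fourier f) z @ \oo).

(* Main.v *)
(* For 2 < q < 4 put p = 4/q, in (1,2), and let r = p/(p-1) be its conjugate
   exponent. Hypothesis (ii) at r says that P is a contraction from L^r to H^q;
   by duality P is a contraction from L^(q') to H^p. Pairing f_rho with
   g = |f_rho|^(q-2) f_rho, whose L^(q') norm is |f_rho|_q^(q-1), and applying
   the Cauchy-Schwarz inequality with weights c_{q/2} = c_{2/p} and then (i) to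
   P g gives the claim. For q = 2 the claim is Parseval's identity. For q >= 4
   it follows from the claim at q/2 applied to f^2, because
   c_b(j+m) (j+1) (m+1) <= c_{2b}(j) c_{2b}(m) for b >= 1 and
   sum_{j+m=n} 1/((j+1)(m+1)) <= 1. *)
Require Import Defs.
From mathcomp Require Import all_boot all_order all_algebra.
From mathcomp Require Import all_classical all_reals all_analysis.
From mathcomp Require Import measurable_realfun ring lra zify.

Import Order.TTheory GRing.Theory Num.Theory.
Import numFieldNormedType.Exports.

Local Open Scope classical_set_scope.
Local Open Scope ring_scope.

(* [arc] alone would refer to [path.arc]. *)
Local Notation arc := Defs.arc.

(** * The coefficients of the binomial series *)

(** The split of the range comes from (i): it is available only for [1 < p < 2], so [p = 4/q]
    reaches exactly [2 < q < 4]. The exponents fit because [4 (1 - 1/r) = 4/p = q], whose conjugate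
    [q/(q-1)] is [4/(4-p)]. No boundary values and no abstract duality of Lebesgue spaces enter.
    Every analytic function is taken on a circle of radius [s < 1], where its partial sums converge
    uniformly and it is bounded; self-adjointness of [P] becomes the symmetry in [g] and [h] of the
    sums of [s^n] times the real part of a product of one Fourier coefficient and the conjugate of
    the other. The dual norm is reached by inserting the extremal test function explicitly.
    Hypotheses on the coefficients are carried as a real bound [B] on all partial sums, which
    survives squaring as [B^2]; passing to [f^2] therefore costs no constant, however often it is
    repeated. Repeated halving of [q] may land exactly on 2, which is why that case is treated
    too. *)

Lemma c_coef0 (R : realType) (x : R) : c_coef x 0 = 1.
Proof. by rewrite /c_coef /gbinom big_ord0 fact0 divr1. Qed.

Lemma c_coefS (R : realType) (x : R) n :
  c_coef x n.+1 = c_coef x n * ((x + n%:R) / n.+1%:R).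
Proof.
rewrite /c_coef /gbinom big_ord_recl factS natrM invfM subr0.
rewrite (eq_bigr (fun k : 'I_n => n%:R + x - 1 - k%:R)); last first.
  by move=> k _; rewrite lift0 -!natr1; ring.
by rewrite -natr1; ring.
Qed.

Lemma c_coef_ge1 (R : realType) (x : R) n : 1 <= x -> 1 <= c_coef x n.
Proof.
move=> x1; elim: n => [|n IH]; first by rewrite c_coef0.
rewrite c_coefS mulr_ege1// ler_pdivlMr ?ltr0n// mul1r -natr1; lra.
Qed.

Lemma c_coef1 (R : realType) n : c_coef (1 : R) n = 1.
Proof.
elim: n => [|n IH]; first by rewrite c_coef0.
by rewrite c_coefS IH mul1r addrC natr1 divff// pnatr_eq0.
Qed.

(** At [b = 1] this is an equality, since [c_1 = 1] and [c_2(j) = j + 1]. For larger [b] the right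
    side grows at least as fast as the left when one index is raised, so induction on each index
    works. *)
Lemma c_coef_conv (R : realType) (b : R) j m : 1 <= b ->
  c_coef b (j + m) * (j.+1%:R * m.+1%:R) <= c_coef (2 * b) j * c_coef (2 * b) m.
Proof.
move=> b1; pose P j m := c_coef b (j + m) * (j.+1%:R * m.+1%:R) <=
  c_coef (2 * b) j * c_coef (2 * b) m; rewrite -/(P j m).
have step i k : P i k -> P i.+1 k.
  rewrite /P addSn !c_coefS => IH.
  have i0 : 0 <= i%:R :> R by [].
  have k0 : 0 <= k%:R :> R by [].
  have c0 : 0 <= c_coef b (i + k) by rewrite (le_trans ler01)// c_coef_ge1.
  have x0 : 0 <= (2 * b + i%:R) / i.+1%:R by rewrite divr_ge0//; lra.
  (* Comparison of the two growth factors; after clearing the denominator, right minus left is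
     [(b - 1) (i + 2 k)]. *)
  have ratio : (b + (i + k)%:R) / (i + k).+1%:R * i.+2%:R <= 2 * b + i%:R.
    rewrite mulrAC ler_pdivrMr ?ltr0n// -!natr1 natrD; nra.
  rewrite [leRHS]mulrAC; apply: le_trans (ler_wpM2r x0 IH).
  set c := c_coef b (i + k) in c0 *; set x := (X in c * X * _).
  have -> : c * (i.+1%:R * k.+1%:R) * ((2 * b + i%:R) / i.+1%:R) =
      c * k.+1%:R * (2 * b + i%:R).
    by field; rewrite nat1r pnatr_eq0.
  have -> : c * x * (i.+2%:R * k.+1%:R) = c * k.+1%:R * (x * i.+2%:R) by ring.
  by rewrite ler_wpM2l// mulr_ge0.
(* By symmetry, [step] in the first index also serves for the second. *)
have PC i k : P i k -> P k i.
  by rewrite /P addnC mulrC -[leRHS]mulrC -[leLHS]mulrC [k.+1%:R * _]mulrC.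
have P0 : P 0 m.
  apply: PC; elim: m => [|m IH]; last exact: step.
  by rewrite /P addn0 !c_coef0 !mulr1.
by elim: j => // j IH; apply: step.
Qed.

(** * Moduli and power series *)

Lemma cabsE (R : realType) (z : R[i]) :
  cabs z = Num.sqrt (complex.Re z ^+ 2 + complex.Im z ^+ 2).
Proof. by case: z. Qed.

Lemma cabs_ge0 (R : realType) (z : R[i]) : 0 <= cabs z.
Proof. by rewrite cabsE sqrtr_ge0. Qed.

Lemma cabsM (R : realType) (z w : R[i]) : cabs (z * w) = cabs z * cabs w.
Proof. exact: Normc.normcM. Qed.

Lemma cabs_norm (R : realType) (z : R[i]) : (cabs z)%:C%C = `|z|.
Proof. by rewrite normc_def cabsE. Qed.

Lemma cabsD (R : realType) (z w : R[i]) : cabs (z + w) <= cabs z + cabs w.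
Proof. exact: le_normcD. Qed.

Lemma cabsN (R : realType) (z : R[i]) : cabs (- z) = cabs z.
Proof. exact: normcN. Qed.

Lemma cabs_distC (R : realType) (z w : R[i]) : cabs (z - w) = cabs (w - z).
Proof. by rewrite -cabsN opprB. Qed.

Lemma cabs0 (R : realType) : cabs (0 : R[i]) = 0.
Proof. exact: Normc.normc0. Qed.

Lemma cabsX (R : realType) (z : R[i]) n : cabs (z ^+ n) = cabs z ^+ n.
Proof.
elim: n => [|n IH]; first by rewrite !expr0 /cabs Normc.normc1.
by rewrite !exprS cabsM IH.
Qed.

Lemma cabsJ (R : realType) (z : R[i]) : cabs (z^*)%C = cabs z.
Proof. by rewrite !cabsE; case: z => a b /=; rewrite sqrrN. Qed.

Lemma cabs_real (R : realType) (x : R) : cabs x%:C%C = `|x|.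
Proof. by rewrite cabsE /= expr0n/= addr0 sqrtr_sqr. Qed.

Lemma Re_le_cabs (R : realType) (z : R[i]) : `|complex.Re z| <= cabs z.
Proof.
by rewrite -[leLHS]sqrtr_sqr cabsE ler_sqrt ?lerDl ?addr_ge0 ?sqr_ge0.
Qed.

Lemma Im_le_cabs (R : realType) (z : R[i]) : `|complex.Im z| <= cabs z.
Proof.
by rewrite -[leLHS]sqrtr_sqr cabsE ler_sqrt ?lerDr ?addr_ge0 ?sqr_ge0.
Qed.

Lemma cabs_le_ReIm (R : realType) (z : R[i]) :
  cabs z <= `|complex.Re z| + `|complex.Im z|.
Proof.
rewrite -[leRHS]ger0_norm ?addr_ge0// -sqrtr_sqr cabsE ler_sqrt ?sqr_ge0//.
by rewrite sqrrD !real_normK ?num_real// lerD2r lerDl mulrn_wge0// mulr_ge0.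
Qed.

Lemma cabs_sum (R : realType) (I : Type) (s : seq I) (F : I -> R[i]) :
  cabs (\sum_(i <- s) F i) <= \sum_(i <- s) cabs (F i).
Proof.
elim: s => [|i s IH]; first by rewrite !big_nil cabs0.
by rewrite !big_cons (le_trans (cabsD _ _ _))// lerD2l.
Qed.

Lemma conjcM (R : realType) (z w : R[i]) : ((z * w)^*)%C = (z^*)%C * (w^*)%C.
Proof. exact: rmorphM. Qed.

Lemma mulcJ (R : realType) (z : R[i]) : z * (z^*)%C = (cabs z ^+ 2)%:C%C.
Proof. by rewrite -sqr_normc -cabs_norm rmorphXn. Qed.

Lemma expiD (R : realType) (s t : R) : expi (s + t) = expi s * expi t.
Proof. by rewrite /expi cosD sinD; simpc; congr (_ +i* _)%C; rewrite addrC. Qed.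

Lemma expiX (R : realType) (t : R) n : expi t ^+ n = expi (n%:R * t).
Proof.
elim: n => [|n IH]; first by rewrite expr0 mul0r /expi cos0 sin0.
by rewrite exprS IH -expiD -natr1 mulrDl mul1r addrC.
Qed.

Lemma expiN (R : realType) (t : R) : expi (- t) = ((expi t)^*)%C.
Proof. by rewrite /expi cosN sinN. Qed.

Lemma cabs_expi (R : realType) (t : R) : cabs (expi t) = 1.
Proof. by rewrite cabsE /= cos2Dsin2 sqrtr1. Qed.

Lemma ccvgP (R : realType) (u : nat -> R[i]^o) (l : R[i]) :
  (u @ \oo --> (l : R[i]^o)) <-> (cabs (u n - l) @[n --> \oo] --> (0 : R)).
Proof.
split=> [/cvgrPdist_lt ul|ul].
  apply/cvgrPdist_lt => e e0.
  have e0' : 0 < e%:C%C by rewrite ltcR.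
  near=> n.
  rewrite sub0r normrN ger0_norm ?cabs_ge0// -ltcR cabs_norm distrC.
  near: n; exact: ul.
(* In the partial order of [R[i]], [0 < e] forces [e] to be real. *)
apply/cvgrPdist_lt => e; rewrite ltcE => /andP[/= /eqP Ime e0].
have -> : e = (complex.Re e)%:C%C by rewrite [LHS]complexE Ime mulr0 addr0.
move/cvgrPdist_lt : ul => /(_ _ e0) ul.
near=> n.
rewrite distrC -cabs_norm ltcR.
have : `|0 - cabs (u n - l)| < complex.Re e by near: n.
by rewrite sub0r normrN ger0_norm ?cabs_ge0.
Unshelve. all: by end_near. Qed.

Lemma ccvg_Re (R : realType) (u : nat -> R[i]^o) (l : R[i]) :
  u @ \oo --> (l : R[i]^o) -> complex.Re (u n) @[n --> \oo] --> complex.Re l.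
Proof.
move=> /ccvgP ul; apply/subr_cvg0/norm_cvg0P.
apply: squeeze_cvgr ul; [near=> n|exact: cvg_cst].
by rewrite normr_ge0/= (le_trans _ (Re_le_cabs _ _))//; case: (u n) l => ? ? [].
Unshelve. all: by end_near. Qed.

Lemma ccvg_Im (R : realType) (u : nat -> R[i]^o) (l : R[i]) :
  u @ \oo --> (l : R[i]^o) -> complex.Im (u n) @[n --> \oo] --> complex.Im l.
Proof.
move=> /ccvgP ul; apply/subr_cvg0/norm_cvg0P.
apply: squeeze_cvgr ul; [near=> n|exact: cvg_cst].
by rewrite normr_ge0/= (le_trans _ (Im_le_cabs _ _))//; case: (u n) l => ? ? [].
Unshelve. all: by end_near. Qed.

Lemma ccvg_ReIm (R : realType) (u : nat -> R[i]^o) (x y : R) :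
  complex.Re (u n) @[n --> \oo] --> x ->
  complex.Im (u n) @[n --> \oo] --> y -> u @ \oo --> ((x +i* y)%C : R[i]^o).
Proof.
move=> /subr_cvg0/cvg_norm ux /subr_cvg0/cvg_norm uy; apply/ccvgP.
rewrite normr0 in ux uy.
have uv : `|complex.Re (u n) - x| + `|complex.Im (u n) - y| @[n --> \oo] -->
  (0 : R).
  by rewrite -[0]addr0; apply: cvgD.
apply: squeeze_cvgr uv; [near=> n|exact: cvg_cst].
 rewrite cabs_ge0/= (le_trans (cabs_le_ReIm _ _))//.
by case: (u n).
Unshelve. all: by end_near. Qed.

Lemma ccvg_bound (R : realType) (u : nat -> R[i]^o) (l : R[i]) (t : nat -> R) :
  (forall n, cabs (u n - l) <= t n) -> t @ \oo --> (0 : R) ->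
  u @ \oo --> (l : R[i]^o).
Proof.
move=> ut t0; apply/ccvgP; apply: squeeze_cvgr t0; [near=> n|exact: cvg_cst].
by rewrite cabs_ge0 ut.
Unshelve. all: by end_near. Qed.

Lemma ccvg_unique (R : realType) (u : nat -> R[i]^o) (l m : R[i]) :
  u @ \oo --> (l : R[i]^o) -> u @ \oo --> (m : R[i]^o) -> l = m.
Proof. exact: cvg_unique. Qed.

Lemma ccvg_cabs_le (R : realType) (u : nat -> R[i]^o) (l z : R[i]) (x : R) :
  u @ \oo --> (l : R[i]^o) -> (\forall n \near \oo, cabs (u n - z) <= x) ->
  cabs (l - z) <= x.
Proof.
move=> /ccvgP ul ux; apply/ler_addgt0Pr => e e0.
near \oo => n.
have n1 : cabs (u n - l) < e.
  rewrite -[ltLHS]ger0_norm ?cabs_ge0//.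
  by near: n; exact: cvgr0_norm_lt.
have n2 : cabs (u n - z) <= x by near: n.
have -> : l - z = (u n - z) + (l - u n) by ring.
by rewrite (le_trans (cabsD _ _ _))// lerD// cabs_distC ltW.
Unshelve. all: by end_near. Qed.

Section geometric_domination.
Variables (R : realType) (b : nat -> R[i]) (K s : R).
Hypotheses (s0 : 0 <= s) (s1 : s < 1).
Hypothesis bK : forall n, cabs (b n) <= K.

(** Comparison with a geometric series. A uniform coefficient bound is enough for every series
    below: Fourier coefficients of bounded functions have one, and so do coefficients whose square
    sum with weights at least 1 is bounded. *)
Lemma power_series_cauchy (z : R[i]) N M : cabs z <= s -> (N <= M)%N ->
  cabs (power_series b z M - power_series b z N) <= K * s ^+ N / (1 - s).
Proof.
move=> zs NM; have K0 : 0 <= K by rewrite (le_trans (cabs_ge0 _ (b 0)))// bK.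
rewrite /power_series /series/= (@big_cat_nat _ _ _ N 0 M)//=
  addrAC subrr add0r.
apply: le_trans (cabs_sum _ _ _ _) _.
apply: (@le_trans _ _ (\sum_(N <= k < M) K * s ^+ k)).
  apply: ler_sum => k _; rewrite cabsM cabsX ler_pM ?exprn_ge0 ?cabs_ge0//.
  by rewrite lerXn2r ?nnegrE ?cabs_ge0.
rewrite -mulr_sumr -mulrA ler_wpM2l// ler_pdivlMr ?subr_gt0//.
(* The factor [1 - s] makes the geometric sum telescope. *)
rewrite mulr_suml (eq_bigr (fun k => - (s ^+ k.+1 - s ^+ k))); last first.
  by move=> k _; rewrite exprS; ring.
by rewrite sumrN telescope_sumr// opprB lerBlDr lerDl exprn_ge0.
Qed.

Lemma tail_cvg0 : K * s ^+ n / (1 - s) @[n --> \oo] --> (0 : R).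
Proof.
rewrite -(mul0r (1 - s)^-1) -[X in X * _](mulr0 K).
apply: cvgMr_tmp; apply: cvgMl_tmp; apply: cvg_expr; by rewrite ger0_norm.
Qed.

Lemma power_series_tail (z l : R[i]) N : cabs z <= s ->
  power_series b z @ \oo --> (l : R[i]^o) ->
  cabs (l - power_series b z N) <= K * s ^+ N / (1 - s).
Proof.
move=> zs /ccvg_cabs_le; apply; near=> M; apply: power_series_cauchy => //.
by near: M; exact: nbhs_infty_ge.
Unshelve. all: by end_near. Qed.

Lemma power_series_bound (z l : R[i]) : cabs z <= s ->
  power_series b z @ \oo --> (l : R[i]^o) -> cabs l <= K / (1 - s).
Proof.
move=> zs /(power_series_tail _ _ 0 zs).
by rewrite /power_series /series/= big_geq// subr0 expr0 mulr1.
Qed.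

Lemma power_series_cvg (z : R[i]) : cabs z <= s ->
  exists l : R[i], power_series b z @ \oo --> (l : R[i]^o).
Proof.
move=> zs.
(* [p] stands for the real or the imaginary part: both are additive and dominated by the modulus, so
   absolute convergence of real series applies. *)
have dom (p : R[i] -> R) : {morph p : x y / x + y} -> p 0 = 0 ->
    (forall w, `|p w| <= cabs w) -> cvgn (fun n => p (power_series b z n)).
  move=> pD p0 pc; have -> : (fun n => p (power_series b z n)) =
      series (fun n => p (b n * z ^+ n)).
    by apply/funext => n; rewrite /power_series /series/= (big_morph p pD p0).
  apply: normed_cvg.
  apply: (@series_le_cvg _ _ (geometric K s)) => [n|n|n|].
  - exact: normr_ge0.
  - by rewrite /geometric/= mulr_ge0 ?exprn_ge0// (le_trans (cabs_ge0 _ _)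
      (bK n)).
  - rewrite /geometric/= (le_trans (pc _))// cabsM cabsX.
    rewrite ler_pM ?exprn_ge0 ?cabs_ge0//.
    by rewrite lerXn2r ?nnegrE ?cabs_ge0.
  - by apply: is_cvg_geometric_series; rewrite ger0_norm.
have cRe : cvgn (fun n => complex.Re (power_series b z n)).
  by apply: dom => // [[? ?] [? ?]//|]; exact: Re_le_cabs.
have cIm : cvgn (fun n => complex.Im (power_series b z n)).
  by apply: dom => // [[? ?] [? ?]//|]; exact: Im_le_cabs.
eexists; apply: ccvg_ReIm; [exact: cRe | exact: cIm].
Qed.

End geometric_domination.

(** [riesz] is defined through [lim], which carries information only once convergence is known;
    bounded coefficients provide it. *)
Lemma riesz_expansion (R : realType) (f : R[i] -> R[i]) (K : R) :
  (forall n, cabs (fourier f n) <= K) -> disc_expansion (riesz f) (fourier f).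
Proof.
move=> fK z z1; have [l zl] :=
  power_series_cvg _ _ _ _ (cabs_ge0 _ z) z1 fK z (lexx _).
by rewrite /riesz (cvg_lim _ zl).
Qed.

(** * Bounded measurable functions of the angle *)

(** A class closed under the algebra used below and contained in every Lebesgue space of the
    probability [arc], so that integrability never has to be discussed separately. The bound is
    required at every point, not almost everywhere. *)
Definition bmeas {R : realType} (u : R -> R) : Prop :=
  measurable_fun [set: R] u /\ exists M, forall t, `|u t| <= M.

Definition cbmeas {R : realType} (u : R -> R[i]) : Prop :=
  bmeas (fun t => complex.Re (u t)) /\ bmeas (fun t => complex.Im (u t)).

(** Componentwise as in [fourier], so that Fourier coefficients are instances of [cint] by
    conversion. *)
Definition cint {R : realType} (f : R -> R[i]) : R[i] :=
  ((\int[arc]_t complex.Re (f t)) +i* (\int[arc]_t complex.Im (f t)))%C.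

Section bounded_measurable.
Variable R : realType.
Implicit Types (u v : R -> R) (f g : R -> R[i]).

Lemma bmeas_integrable u : bmeas u -> (@arc R).-integrable setT (EFin \o u).
Proof.
move=> [mu [M uM]]; apply: measurable_bounded_integrable => //.
  by rewrite (le_lt_trans (probability_le1 _ _))// ltry.
exists M; split; first exact: num_real.
by move=> x Mx t _; apply: le_trans (uM t) _; exact: ltW.
Qed.

Lemma bmeasD u v : bmeas u -> bmeas v -> bmeas (fun t => u t + v t).
Proof.
move=> [mu [M uM]] [mv [N vN]]; split; first exact: measurable_funD.
by exists (M + N) => t; rewrite (le_trans (ler_normD _ _))// lerD.
Qed.

Lemma bmeasN u : bmeas u -> bmeas (fun t => - u t).
Proof.
by move=> [mu [M uM]]; split; [exact: measurableT_comp|exists M => t;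
  rewrite normrN].
Qed.

Lemma bmeasB u v : bmeas u -> bmeas v -> bmeas (fun t => u t - v t).
Proof. by move=> bu bv; apply: bmeasD => //; exact: bmeasN. Qed.

Lemma bmeasM u v : bmeas u -> bmeas v -> bmeas (fun t => u t * v t).
Proof.
move=> [mu [M uM]] [mv [N vN]]; split; first exact: measurable_funM.
by exists (M * N) => t; rewrite normrM ler_pM.
Qed.

Lemma bmeas_cst (c : R) : bmeas (fun=> c).
Proof. by split; [exact: measurable_cst|exists `|c|]. Qed.

Lemma bmeas_norm u : bmeas u -> bmeas (fun t => `|u t|).
Proof.
by move=> [mu [M uM]]; split; [exact: measurableT_comp|exists M => t;
  rewrite normr_id].
Qed.

Lemma bmeas_powR u (r : R) : 0 <= r -> (forall t, 0 <= u t) -> bmeas u ->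
  bmeas (fun t => u t `^ r).
Proof.
move=> r0 u0 [mu [M uM]]; split.
  exact: (measurableT_comp (measurable_powR _)).
exists (M `^ r) => t; rewrite ger0_norm ?powR_ge0//.
have uM' : u t <= M by rewrite -[leLHS]ger0_norm.
by rewrite ge0_ler_powR ?nnegrE// (le_trans (u0 t)).
Qed.

Lemma cbmeasP f : measurable_fun [set: R] (fun t => complex.Re (f t)) ->
  measurable_fun [set: R] (fun t => complex.Im (f t)) ->
  (exists M, forall t, cabs (f t) <= M) -> cbmeas f.
Proof.
move=> mR mI [M fM]; split; split=> //; exists M => t.
  exact: le_trans (Re_le_cabs _ _) (fM t).
exact: le_trans (Im_le_cabs _ _) (fM t).
Qed.

Lemma cbmeas_bound f : cbmeas f -> exists M, forall t, cabs (f t) <= M.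
Proof.
move=> [[_ [M fM]] [_ [N fN]]]; exists (M + N) => t.
by rewrite (le_trans (cabs_le_ReIm _ _))// lerD.
Qed.

Lemma cbmeasB f g : cbmeas f -> cbmeas g -> cbmeas (fun t => f t - g t).
Proof.
move=> [fR fI] [gR gI]; split.
  rewrite (_ : (fun t => _) = fun t => complex.Re (f t) - complex.Re (g t)).
    exact: bmeasB.
  by apply/funext => t; case: (f t) (g t) => ? ? [].
rewrite (_ : (fun t => _) = fun t => complex.Im (f t) - complex.Im (g t)).
  exact: bmeasB.
by apply/funext => t; case: (f t) (g t) => ? ? [].
Qed.

Lemma cReM (z w : R[i]) : complex.Re (z * w) =
  complex.Re z * complex.Re w - complex.Im z * complex.Im w.
Proof. by case: z w => ? ? []. Qed.

Lemma cImM (z w : R[i]) : complex.Im (z * w) =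
  complex.Re z * complex.Im w + complex.Im z * complex.Re w.
Proof. by case: z w => ? ? []. Qed.

Lemma cbmeasM f g : cbmeas f -> cbmeas g -> cbmeas (fun t => f t * g t).
Proof.
move=> [fR fI] [gR gI]; split.
  by under eq_fun do rewrite cReM; apply: bmeasB; exact: bmeasM.
by under eq_fun do rewrite cImM; apply: bmeasD; exact: bmeasM.
Qed.

Lemma cbmeas_cst (c : R[i]) : cbmeas (fun=> c).
Proof. by split; exact: bmeas_cst. Qed.

Lemma cbmeasJ f : cbmeas f -> cbmeas (fun t => (f t)^*%C).
Proof.
move=> [fR fI]; split.
  by rewrite (_ : (fun t => _) = fun t => complex.Re (f t))//;
    apply/funext => t; case: (f t).
rewrite (_ : (fun t => _) = fun t => - complex.Im (f t)); first exact: bmeasN.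
by apply/funext => t; case: (f t).
Qed.

Lemma cbmeas_expi (k : R) : cbmeas (fun t => expi (k * t)).
Proof.
split; split => /=.
- apply: (measurableT_comp (continuous_measurable_fun (@continuous_cos R))) =>
    //.
- by exists 1 => t; rewrite ler_norml cos_geN1 cos_le1.
- apply: (measurableT_comp (continuous_measurable_fun (@continuous_sin R))) =>
    //.
- by exists 1 => t; rewrite ler_norml sin_geN1 sin_le1.
Qed.

Lemma cbmeas_expiX n : cbmeas (fun t : R => expi t ^+ n).
Proof. by under eq_fun do rewrite expiX; exact: cbmeas_expi. Qed.

Lemma cbmeas_sum n (F : nat -> R -> R[i]) : (forall k, cbmeas (F k)) ->
  cbmeas (fun t => \sum_(0 <= k < n) F k t).
Proof.
move=> cF; elim: n => [|n IH].
  by under eq_fun do rewrite big_nil; exact: cbmeas_cst.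
(* A sum [x + y] is written [x - (0 - y)], so that closure under differences suffices. *)
under eq_fun do rewrite big_nat_recr//= -[F n _]opprK -[- F n _]sub0r.
by apply: cbmeasB => //; apply: cbmeasB => //; exact: cbmeas_cst.
Qed.

Lemma bmeas_cabs f : cbmeas f -> bmeas (fun t => cabs (f t)).
Proof.
move=> bf; split; last first.
  have [M fM] := cbmeas_bound _ bf.
  by exists M => t; rewrite ger0_norm ?cabs_ge0.
under eq_fun do rewrite cabsE.
apply: (measurableT_comp (continuous_measurable_fun (@sqrt_continuous R))) =>
  //.
by case: bf => -[mR _] [mI _]; apply: measurable_funD; exact: measurable_funX.
Qed.

Lemma arc_int_cst (c : R) : \int[@Defs.arc R]_t c = c.
Proof. by rewrite Rintegral_cst//= (@probability_setT _ _ _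
  (@Defs.arc R)) mulr1. Qed.

Lemma le_arc_int u v : bmeas u -> bmeas v -> (forall t, u t <= v t) ->
  \int[arc]_t u t <= \int[arc]_t v t.
Proof.
by move=> bu bv uv; apply: le_Rintegral => //; exact: bmeas_integrable.
Qed.

Lemma arc_int_bound u M : bmeas u -> (forall t, `|u t| <= M) ->
  `|\int[arc]_t u t| <= M.
Proof.
move=> bu uM; apply: (le_trans (le_normr_Rintegral _
  (bmeas_integrable _ bu))) => //.
rewrite -(arc_int_cst M); apply: le_arc_int => //; first exact: bmeas_norm.
exact: bmeas_cst.
Qed.

(** Real and imaginary parts are bounded separately. The lost factor 2 is harmless: the bound only
    serves to show that errors tend to 0 and that coefficients are bounded. *)
Lemma cint_bound f M : cbmeas f -> (forall t, cabs (f t) <= M) ->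
  cabs (cint f) <= M + M.
Proof.
move=> [fR fI] fM; rewrite (le_trans (cabs_le_ReIm _ _))// lerD//=.
  by apply: arc_int_bound => // t; exact: le_trans (Re_le_cabs _ _) (fM t).
by apply: arc_int_bound => // t; exact: le_trans (Im_le_cabs _ _) (fM t).
Qed.

Lemma cintB f g : cbmeas f -> cbmeas g ->
  cint (fun t => f t - g t) = cint f - cint g.
Proof.
move=> [fR fI] [gR gI]; rewrite /cint.
have -> : (fun t => complex.Re (f t - g t)) =
    fun t => complex.Re (f t) - complex.Re (g t).
  by apply/funext => t; case: (f t) (g t) => ? ? [].
have -> : (fun t => complex.Im (f t - g t)) =
    fun t => complex.Im (f t) - complex.Im (g t).
  by apply/funext => t; case: (f t) (g t) => ? ? [].
by rewrite !RintegralB//; exact: bmeas_integrable.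
Qed.

Lemma cint0 : cint (fun=> 0 : R[i]) = 0.
Proof. by rewrite /cint !arc_int_cst. Qed.

Lemma cintZ (c : R[i]) f : cbmeas f -> cint (fun t => c * f t) = c * cint f.
Proof.
move=> [fR fI]; rewrite /cint.
under eq_Rintegral do rewrite cReM.
under [X in (_ +i* X)%C]eq_Rintegral do rewrite cImM.
rewrite RintegralB ?RintegralD//;
  try by apply: bmeas_integrable; apply: bmeasM => //; exact: bmeas_cst.
rewrite !RintegralZl//; try exact: bmeas_integrable.
by case: c.
Qed.

Lemma cint_sum n (F : nat -> R -> R[i]) : (forall k, cbmeas (F k)) ->
  cint (fun t => \sum_(0 <= k < n) F k t) = \sum_(0 <= k < n) cint (F k).
Proof.
move=> cF; elim: n => [|n IH].
  by under eq_fun do rewrite big_nil; rewrite big_nil cint0.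
rewrite big_nat_recr//= -IH.
have -> : (fun t => \sum_(0 <= k < n.+1) F k t) =
    fun t => \sum_(0 <= k < n) F k t - (0 - F n t).
  by apply/funext => t; rewrite big_nat_recr//= sub0r opprK.
rewrite !cintB ?cint0 ?sub0r ?opprK//; try exact: cbmeas_cst; try
  exact: cbmeas_sum.
by apply: cbmeasB => //; exact: cbmeas_cst.
Qed.

Lemma cintJ f : cbmeas f -> cint (fun t => (f t)^*%C) = ((cint f)^*)%C.
Proof.
move=> [fR fI]; rewrite /cint/=; congr (_ +i* _)%C.
  by apply: eq_Rintegral => t _; case: (f t).
rewrite -mulN1r -RintegralZl//; last exact: bmeas_integrable.
by apply: eq_Rintegral => t _; rewrite mulN1r; case: (f t).
Qed.

End bounded_measurable.

(** * The pairing of a dilated power series with a function on the circle *)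

Section circle_integrals.
Variable R : realType.
Implicit Types (u v : R -> R) (f g h : R[i] -> R[i]).

Lemma arc_LnormE u (r : R) : bmeas u -> 0 < r ->
  'N[arc]_r%:E[EFin \o u]%E = ((\int[arc]_t (`|u t| `^ r)) `^ r^-1)%:E.
Proof.
move=> bu r0; rewrite unlock /=.
have bi : (@Defs.arc R).-integrable setT (EFin \o (fun t => `|u t| `^ r)).
  by apply: bmeas_integrable; apply: bmeas_powR; [exact: ltW| |exact:
    bmeas_norm].
rewrite -(fineK (integrable_fin_num _ bi))//.
Qed.

Lemma circle_normE f (r : R) : cbmeas (fun t => f (expi t)) -> 0 < r ->
  circle_norm r f = ((\int[arc]_t (cabs (f (expi t)) `^ r)) `^ r^-1)%:E.
Proof.
move=> bf r0; transitivity 'N[arc]_r%:E[EFin \o (fun t => cabs (f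
  (expi t)))]%E => //.
rewrite (arc_LnormE _ _ (bmeas_cabs _ _ bf) r0).
by under eq_Rintegral do rewrite (ger0_norm (cabs_ge0 _ _)).
Qed.

Lemma arc_hoelder u v (p q : R) : bmeas u -> bmeas v ->
  (forall t, 0 <= u t) -> (forall t, 0 <= v t) ->
  0 < p -> 0 < q -> p^-1 + q^-1 = 1 ->
  \int[arc]_t (u t * v t) <=
  (\int[arc]_t (u t `^ p)) `^ p^-1 * (\int[arc]_t (v t `^ q)) `^ q^-1.
Proof.
move=> bu bv u0 v0 p0 q0 pq.
have := @hoelder _ _ _ (@Defs.arc R) u v p q bu.1 bv.1 p0 q0 pq.
rewrite (arc_LnormE _ _ (bmeasM _ _ _ bu bv) ltr01) (arc_LnormE _ _ bu p0)
  (arc_LnormE _ _ bv q0).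
rewrite -EFinM lee_fin invr1 powRr1; last by apply: Rintegral_ge0 => t _;
  exact: powR_ge0.
under eq_Rintegral do rewrite powRr1// ger0_norm ?mulr_ge0//.
under [X in _ <= X `^ _ * _ -> _]eq_Rintegral do rewrite ger0_norm//.
by under [X in _ <= _ * X `^ _ -> _]eq_Rintegral do rewrite ger0_norm//.
Qed.

Lemma cabs_polar (s t : R) : 0 <= s -> cabs (s%:C%C * expi t) = s.
Proof. by move=> s0; rewrite cabsM cabs_real cabs_expi mulr1 ger0_norm. Qed.

Section pairing.
Variables (F : R[i] -> R[i]) (b : nat -> R[i]) (K s : R).
Hypotheses (Fb : disc_expansion F b) (bK : forall n, cabs (b n) <= K).
Hypotheses (s0 : 0 <= s) (s1 : s < 1).

Lemma cbmeas_partial N : cbmeas (fun t => power_series b (s%:C%C * expi t) N).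
Proof.
apply: (cbmeas_sum R N (fun k t => b k * (s%:C%C * expi t) ^+ k)) => k.
under eq_fun do rewrite exprMn.
apply: cbmeasM; first exact: cbmeas_cst.
by apply: cbmeasM; [exact: cbmeas_cst|exact: cbmeas_expiX].
Qed.

Lemma disc_expansion_polar (t : R) :
  power_series b (s%:C%C * expi t) @ \oo --> (F (s%:C%C * expi t) : R[i]^o).
Proof. by apply: Fb; rewrite cabs_polar. Qed.

Lemma cbmeas_disc : cbmeas (fun t => F (s%:C%C * expi t)).
Proof.
apply: cbmeasP.
- apply: (@measurable_fun_cvg _ _ _ _
    (fun N t => complex.Re (power_series b (s%:C%C * expi t) N))).
    by move=> N; case: (cbmeas_partial N) => -[].
  by move=> t _; apply: ccvg_Re; exact: disc_expansion_polar.
- apply: (@measurable_fun_cvg _ _ _ _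
    (fun N t => complex.Im (power_series b (s%:C%C * expi t) N))).
    by move=> N; case: (cbmeas_partial N) => _ [].
  by move=> t _; apply: ccvg_Im; exact: disc_expansion_polar.
- exists (K / (1 - s)) => t;
    apply: power_series_bound s1 bK _ _ _ (disc_expansion_polar t) => //.
  by rewrite cabs_polar.
Qed.

(** On the circle of radius [s] the partial sums converge uniformly, so they may be integrated
    against the bounded [h] term by term. This one limit yields the symmetry of [P], the
    coefficients of a dilate, the square-mean bound and the main estimate. *)
Lemma pairing_cvg h : cbmeas (fun t => h (expi t)) ->
  (fun N => \sum_(0 <= n < N) b n * (s ^+ n)%:C%C * (fourier h n)^*%C : R[i]^o)
    @ \oo -->
  (cint (fun t => F (s%:C%C * expi t) * (h (expi t))^*%C) : R[i]^o).
Proof.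
move=> bh; have [M hM] := cbmeas_bound _ _ bh.
have M0 : 0 <= M by rewrite (le_trans (cabs_ge0 _ _) (hM 0)).
have bhJ := cbmeasJ _ _ bh.
have coefE k : (fourier h k)^*%C =
  cint (fun t => expi t ^+ k * (h (expi t))^*%C).
  rewrite -cintJ; last first.
    apply: cbmeasM => //.
    rewrite (_ : (fun t => _) = fun t => expi (- k%:R * t)); first
      exact: cbmeas_expi.
    by apply/funext => t; rewrite mulNr.
  congr cint; apply/funext => t.
  by rewrite conjcM expiN conjcK -expiX mulrC.
have sumE N : \sum_(0 <= n < N) b n * (s ^+ n)%:C%C * (fourier h n)^*%C =
    cint (fun t => power_series b (s%:C%C * expi t) N * (h (expi t))^*%C).
  have -> : (fun t => power_series b (s%:C%C * expi t) N * (h (expi t))^*%C) =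
     fun t => \sum_(0 <= n < N)
       b n * (s ^+ n)%:C%C * (expi t ^+ n * (h (expi t))^*%C).
    apply/funext => t; rewrite /power_series /series/= mulr_suml.
    by apply: eq_bigr => n _; rewrite exprMn rmorphXn/=; ring.
  rewrite cint_sum; last first.
    move=> k; apply: cbmeasM; first exact: cbmeas_cst.
    by apply: cbmeasM => //; exact: cbmeas_expiX.
  apply: eq_bigr => n _; rewrite cintZ ?coefE//.
  by apply: cbmeasM => //; exact: cbmeas_expiX.
apply: (ccvg_bound _ _ _ (fun N => K * s ^+ N / (1 - s) * M +
  K * s ^+ N / (1 - s) * M)).
  move=> N; rewrite sumE -cintB; last 2 first.
    by apply: cbmeasM => //; exact: cbmeas_partial.
    by apply: cbmeasM => //; exact: cbmeas_disc.
  apply: cint_bound.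
    by apply: cbmeasB; apply: cbmeasM => //; [exact: cbmeas_partial|exact:
      cbmeas_disc].
  move=> t; rewrite -mulrBl cabsM cabsJ ler_pM ?cabs_ge0//.
  rewrite cabs_distC; apply: power_series_tail s0 s1 bK _ _ _ _
    (disc_expansion_polar t).
  by rewrite cabs_polar.
have := tail_cvg0 _ K s s0 s1 => /cvgMr_tmp - /(_ M); rewrite mul0r => tM.
by rewrite -[X in _ --> X]addr0; apply: cvgD.
Qed.

End pairing.

Lemma fourier_bound h M : cbmeas (fun t => h (expi t)) ->
  (forall t, cabs (h (expi t)) <= M) -> forall n, cabs (fourier h n) <= M + M.
Proof.
move=> bh hM n; apply: cint_bound.
  apply: cbmeasM => //.
  rewrite (_ : (fun t => _) = fun t => expi (- n%:R * t)); first
    exact: cbmeas_expi.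
  by apply/funext => t; rewrite mulNr.
by move=> t; rewrite cabsM cabs_expi mulr1.
Qed.

Lemma riesz_expansion_bounded h : cbmeas (fun t => h (expi t)) ->
  disc_expansion (riesz h) (fourier h) /\
    exists K, forall n, cabs (fourier h n) <= K.
Proof.
move=> bh; have [M hM] := cbmeas_bound _ _ bh.
have hK := fourier_bound h M bh hM.
by split; [exact: riesz_expansion hK|exists (M + M)].
Qed.

(** Self-adjointness of [P] followed by dilation by [s]. The two complex pairings are conjugate to
    each other, hence the real parts. *)
Lemma riesz_sym g h (s : R) : cbmeas (fun t => g (expi t)) ->
  cbmeas (fun t => h (expi t)) -> 0 <= s -> s < 1 ->
  \int[arc]_t complex.Re (riesz g (s%:C%C * expi t) * (h (expi t))^*%C) =
  \int[arc]_t complex.Re (riesz h (s%:C%C * expi t) * (g (expi t))^*%C).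
Proof.
move=> bg bh s0 s1.
have [eg [K gK]] := riesz_expansion_bounded g bg.
have [eh [L hL]] := riesz_expansion_bounded h bh.
have /ccvg_Re cg := pairing_cvg _ _ K s eg gK s0 s1 h bh.
have /ccvg_Re ch := pairing_cvg _ _ L s eh hL s0 s1 g bg.
pose S f1 f2 N : R := complex.Re
    (\sum_(0 <= n < N) fourier f1 n * (s ^+ n)%:C%C * (fourier f2 n)^*%C).
have {}cg : S g h @ \oo --> complex.Re
  (cint (fun t => riesz g (s%:C%C * expi t) * (h (expi t))^*%C)) by exact: cg.
have {}ch : S h g @ \oo --> complex.Re
  (cint (fun t => riesz h (s%:C%C * expi t) * (g (expi t))^*%C)) by exact: ch.
suff SC : S g h = S h g by rewrite -SC in ch; exact: (cvg_unique _ cg ch).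
apply/funext => N; rewrite /S.
have Resum (G : nat -> R[i]) :
  complex.Re (\sum_(0 <= n < N) G n) = \sum_(0 <= n < N) complex.Re (G n).
  have ReD : {morph (@complex.Re R) : x y / x + y} by move=> [? ?] [? ?].
  by rewrite (big_morph _ ReD (erefl : complex.Re 0 = 0)).
rewrite !Resum; apply: eq_bigr => n _.
case: (fourier g n) (fourier h n) => a b [c d] /=; ring.
Qed.

End circle_integrals.

(** * The range 2 < q < 4 *)

Lemma circle_norm_le_hardy (R : realType) (p : R) (f : R[i] -> R[i]) (s : R) :
  0 < s < 1 ->
  (circle_norm p (fun z => f (s%:C%C * z)%R) <= hardy_norm p f)%E.
Proof. by move=> s01; apply: ereal_sup_ubound; exists s. Qed.

Lemma hardy_norm_le (R : realType) (p : R) (f : R[i] -> R[i]) (x : \bar R) :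
  (forall s, 0 < s < 1 -> (circle_norm p (fun z => f (s%:C%C * z)%R) <= x)%E) ->
  (hardy_norm p f <= x)%E.
Proof. by move=> fx; apply: ge_ereal_sup => _ [s s01 <-]; exact: fx. Qed.

Lemma cauchy_schwarz_sum (R : realType) (N : nat) (x y w : nat -> R) :
  (forall n, 0 < w n) ->
  \sum_(0 <= n < N) x n * y n <=
  Num.sqrt (\sum_(0 <= n < N) x n ^+ 2 * w n) *
  Num.sqrt (\sum_(0 <= n < N) y n ^+ 2 / w n).
Proof.
move=> w0; elim: N => [|N IH]; first by rewrite !big_nil sqrtr0 mulr0.
rewrite !big_nat_recr//=; apply: (le_trans (lerD IH (lexx _))).
set X := \sum_(_ <= _ < _) _ * w _; set Y := \sum_(_ <= _ < _) _ / w _.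
have X0 : 0 <= X by apply: sumr_ge0 => n _; rewrite mulr_ge0 ?sqr_ge0// ltW.
have Y0 : 0 <= Y by apply: sumr_ge0 => n _; rewrite divr_ge0 ?sqr_ge0// ltW.
have xw0 : 0 <= x N ^+ 2 * w N by rewrite mulr_ge0 ?sqr_ge0// ltW.
have yw0 : 0 <= y N ^+ 2 / w N by rewrite divr_ge0 ?sqr_ge0// ltW.
rewrite -[leRHS]sqrtrM ?addr_ge0//.
have xyE : (x N ^+ 2 * w N) * (y N ^+ 2 / w N) = (x N * y N) ^+ 2.
  by field; rewrite gt_eqF.
set x2 := x N ^+ 2 * w N in xw0 xyE *; set y2 := y N ^+ 2 / w N in yw0 xyE *.
have xy_le : x N * y N <= Num.sqrt x2 * Num.sqrt y2.
  by rewrite -sqrtrM// xyE sqrtr_sqr ler_norm.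
apply: le_trans (lerD (lexx (Num.sqrt X * Num.sqrt Y)) xy_le) _.
rewrite -[leLHS]ger0_norm ?addr_ge0 ?mulr_ge0 ?sqrtr_ge0// -sqrtr_sqr.
rewrite ler_sqrt ?mulr_ge0 ?addr_ge0//.
rewrite -{2}(sqr_sqrtr X0) -{2}(sqr_sqrtr Y0) -{2}(sqr_sqrtr xw0)
  -{2}(sqr_sqrtr yw0).
(* With the squares expanded, what remains is that twice the product of the two cross terms is at
   most the sum of their squares. *)
have := sqr_ge0 (Num.sqrt X * Num.sqrt y2 - Num.sqrt Y * Num.sqrt x2).
nra.
Qed.

(* For [r < 2] the junk value [0 `^ (r - 2) = 0] is harmless: [phase r 0 = 0]. *)
Definition phase {R : realType} (r : R) (z : R[i]) : R[i] :=
  (cabs z `^ (r - 2))%:C%C * z.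

Section phase.
Variables (R : realType) (r : R).
Hypothesis r1 : 1 < r.

(** The condition [0 < d] keeps the rule valid at [x = 0], even for negative [e]. *)
Lemma powR_succ (x e d : R) : 0 <= x -> d = e + 1 -> 0 < d ->
  x `^ e * x = x `^ d.
Proof.
move=> x0 -> d0; rewrite -{2}(powRr1 x0) -powRD//.
by rewrite gt_eqF.
Qed.

Lemma cabs_phase z : cabs (phase r z) = cabs z `^ (r - 1).
Proof.
rewrite cabsM cabs_real ger0_norm ?powR_ge0//.
by apply: powR_succ; rewrite ?cabs_ge0 ?subr_gt0//; ring.
Qed.

(** This makes [phase r] the extremal test function: pairing a function with its own phase returns
    the integral of its [r]-th power. *)
Lemma mul_phase z : z * (phase r z)^*%C = (cabs z `^ r)%:C%C.
Proof.
rewrite conjcM conjc_real mulrCA mulcJ -rmorphM/=; congr (_%:C%C).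
rewrite expr2 mulrA (@powR_succ _ _ (r - 1)) ?cabs_ge0 ?subr_gt0//;
  last by ring.
by apply: powR_succ; rewrite ?cabs_ge0 ?(lt_trans ltr01)//; ring.
Qed.

Lemma cbmeas_phase (f : R -> R[i]) : cbmeas f ->
  cbmeas (fun t => phase r (f t)).
Proof.
move=> bf; have [[mR _] [mI _]] := bf; have [mC _] := bmeas_cabs _ _ bf.
have mp : measurable_fun [set: R] (fun t => cabs (f t) `^ (r - 2)).
  exact: (measurableT_comp (measurable_powR _)).
apply: cbmeasP.
- by under eq_fun do rewrite /phase cReM/= mul0r subr0; exact: measurable_funM.
- by under eq_fun do rewrite /phase cImM/= mul0r addr0; exact: measurable_funM.
have [M fM] := cbmeas_bound _ _ bf.
exists (M `^ (r - 1)) => t; rewrite cabs_phase.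
by rewrite ge0_ler_powR ?nnegrE ?subr_ge0 ?cabs_ge0 ?(ltW r1)//
  (le_trans (cabs_ge0 _ _) (fM t)).
Qed.

End phase.

(** Last step of both duality arguments: [D] is the integral of a [p]-th power and [e = 1/p], so the
    conclusion bounds the norm. Cancelling [D] to the power [1 - e] requires [D] to be nonzero,
    whence the separate case. *)
Lemma powR_absorb (R : realType) (D X e : R) : 0 <= D -> 0 <= X -> 0 < e ->
  D <= D `^ (1 - e) * X -> D `^ e <= X.
Proof.
move=> D0 X0 e0; move: D0; rewrite le_eqVlt => /predU1P[<- _|D0].
  by rewrite powR0// gt_eqF.
have {1}-> : D = D `^ (1 - e) * D `^ e.
  by rewrite -powRD ?subrK ?powRr1 ?ltW// gt_eqF// implybT.
by rewrite ler_pM2l ?powR_gt0.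
Qed.

Section half_range.
Variable R : realType.
Hypothesis riesz_contr : forall r : R, 2 < r ->
  forall f : R[i] -> R[i], circle_Lspace r f ->
    (hardy_norm (4 * (1 - 1 / r)) (riesz f) <= circle_norm r f)%E.

(** Testing the dilate of [riesz g] against its own phase [h] and moving [P] onto [h] leaves, after
    Hölder, the norm of [riesz h], to which the contraction applies. *)
Lemma riesz_dual (p : R) (g : R[i] -> R[i]) : 1 < p -> p < 2 ->
  cbmeas (fun t => g (expi t)) ->
  (hardy_norm p (riesz g) <= circle_norm (4 / (4 - p)) g)%E.
Proof.
move=> p1 p2 bg; apply: hardy_norm_le => s /andP[s0 s1].
have [eg [K gK]] := riesz_expansion_bounded _ g bg.
pose G t := riesz g (s%:C%C * expi t).
have bG : cbmeas G by apply: cbmeas_disc eg gK _ s1; exact: ltW.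
pose h z := phase p (riesz g (s%:C%C * z)).
have bh : cbmeas (fun t => h (expi t)) by exact: cbmeas_phase.
have [eh [L hL]] := riesz_expansion_bounded _ h bh.
pose H t := riesz h (s%:C%C * expi t).
have bH : cbmeas H by apply: cbmeas_disc eh hL _ s1; exact: ltW.
(* [r] is conjugate to [p], [q] is the target exponent [4 (1 - 1/r)], and [q'] is conjugate to
   [q]. *)
pose r := p / (p - 1); pose q := 4 / p; pose q' := 4 / (4 - p).
have p0 : 0 < p by lra.
have p10 : 0 < p - 1 by lra.
have q0 : 0 < q by rewrite divr_gt0.
have q'0 : 0 < q' by rewrite divr_gt0//; lra.
have r2 : 2 < r by rewrite /r ltr_pdivlMr//; lra.
have r0 : 0 < r by lra.
pose D := \int[arc]_t (cabs (G t) `^ p).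
have D0 : 0 <= D by apply: Rintegral_ge0 => t _; exact: powR_ge0.
have hr : circle_norm r h = (D `^ r^-1)%:E.
  (* The modulus of [h] is that of [G] to the power [p - 1], and [(p - 1) r = p]. *)
  have hD : \int[arc]_t (cabs (h (expi t)) `^ r) = D.
    apply: eq_Rintegral => t _; rewrite cabs_phase// -powRrM; congr (_ `^ _).
    by rewrite /r; field; rewrite gt_eqF.
  by rewrite (circle_normE _ h r bh r0) hD.
have Hq : (\int[arc]_t (cabs (H t) `^ q)) `^ q^-1 <= D `^ r^-1.
  have Hn := circle_normE _ (fun z => riesz h (s%:C%C * z)) q bH q0.
  suff : (circle_norm q (fun z => riesz h (s%:C%C * z)%R) <= circle_norm r h)%E.
    by rewrite Hn hr lee_fin.
  apply: le_trans (circle_norm_le_hardy _ _ _ s _) _; first by rewrite s0.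
  have -> : q = 4 * (1 - 1 / r) by rewrite /q /r; field; rewrite !gt_eqF.
  apply: riesz_contr => //; case: bh => -[mR _] [mI _]; split=> //.
  by rewrite hr ltry.
have Xq : circle_norm q' g =
  ((\int[arc]_t (cabs (g (expi t)) `^ q')) `^ q'^-1)%:E.
  exact: circle_normE.
rewrite (circle_normE _ (fun z => riesz g (s%:C%C * z)) p bG p0) Xq lee_fin.
apply: powR_absorb; rewrite ?powR_ge0 ?invr_gt0//.
have -> : 1 - p^-1 = r^-1 by rewrite /r; field; rewrite !gt_eqF.
have DE : D = \int[arc]_t complex.Re (H t * (g (expi t))^*%C).
  rewrite -(riesz_sym _ g h)//; last exact: ltW.
  by apply: eq_Rintegral => t _; rewrite mul_phase.
apply: (@le_trans _ _ (\int[arc]_t (cabs (H t) * cabs (g (expi t))))).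
  rewrite -/D DE; apply: le_arc_int.
  - by have [] := cbmeasM _ _ _ bH (cbmeasJ _ _ bg).
  - by apply: bmeasM; exact: bmeas_cabs.
  - by move=> t; rewrite (le_trans (ler_norm _))//
      (le_trans (Re_le_cabs _ _))// cabsM cabsJ.
have bcH := bmeas_cabs _ _ bH; have bcg := bmeas_cabs _ _ bg.
apply: le_trans (arc_hoelder _ _ _ q q' bcH bcg _ _ q0 q'0 _) _.
- by move=> t; exact: cabs_ge0.
- by move=> t; exact: cabs_ge0.
- by rewrite /q /q' !invf_div; field.
by rewrite ler_wpM2r ?powR_ge0.
Qed.

Hypothesis coef_ineq : forall p : R, 1 < p -> p < 2 ->
  forall (f : R[i] -> R[i]) (a : nat -> R[i]),
    hardy_space p f -> disc_expansion f a ->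
    (sqrte (\sum_(0 <= n <oo) (cabs (a n) ^+ 2 / c_coef (2 / p) n)%:E)
      <= hardy_norm p f)%E.
(** Supplies the uniform coefficient bound that the geometric estimates require. *)
Lemma coef_le_sqrt (a : nat -> R[i]) (c : nat -> R) (B : R) :
  (forall n, 1 <= c n) ->
  (forall N, \sum_(0 <= n < N) cabs (a n) ^+ 2 * c n <= B) ->
  forall n, cabs (a n) <= Num.sqrt B.
Proof.
move=> c1 aB n; rewrite -[leLHS]ger0_norm ?cabs_ge0// -sqrtr_sqr.
have c0 k : 0 <= c k by exact: le_trans ler01 (c1 k).
have anB : cabs (a n) ^+ 2 <= B.
  rewrite (le_trans _ (aB n.+1))// big_nat_recr//= -[leLHS]add0r lerD//.
    by apply: sumr_ge0 => k _; rewrite mulr_ge0 ?sqr_ge0.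
  by rewrite ler_peMr ?sqr_ge0.
by rewrite ler_sqrt// (le_trans _ anB)// sqr_ge0.
Qed.

Lemma expansion_ineq_lt4 (q B : R) (f : R[i] -> R[i]) (a : nat -> R[i]) :
  2 < q -> q < 4 -> disc_expansion f a ->
  (forall N, \sum_(0 <= n < N) cabs (a n) ^+ 2 * c_coef (q / 2) n <= B) ->
  (hardy_norm q f <= (Num.sqrt B)%:E)%E.
Proof.
move=> q2 q4 fa aB; apply: hardy_norm_le => s /andP[s0 s1].
have q1 : 1 < q by lra.
have q0 : 0 < q by lra.
have c1 n : 1 <= c_coef (q / 2) n by apply: c_coef_ge1; lra.
have c0 n : 0 < c_coef (q / 2) n by exact: lt_le_trans ltr01 (c1 n).
have aK := coef_le_sqrt a (c_coef (q / 2)) B c1 aB.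
pose F t := f (s%:C%C * expi t).
have bF : cbmeas F by apply: cbmeas_disc fa aK _ s1; exact: ltW.
pose g z := phase q (f (s%:C%C * z)).
have bg : cbmeas (fun t => g (expi t)) by exact: cbmeas_phase.
pose p := 4 / q; pose q' := 4 / (4 - p).
have p1 : 1 < p by rewrite /p ltr_pdivlMr//; lra.
have p2 : p < 2 by rewrite /p ltr_pdivrMr//; lra.
have q'E : q' = q / (q - 1).
  by rewrite /q' /p; field; rewrite !gt_eqF//=; lra.
have q'0 : 0 < q' by rewrite q'E divr_gt0//; lra.
pose J := \int[arc]_t (cabs (F t) `^ q).
have J0 : 0 <= J by apply: Rintegral_ge0 => t _; exact: powR_ge0.
have qi : q'^-1 = 1 - q^-1 by rewrite q'E invf_div; field; rewrite gt_eqF.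
pose X := J `^ (1 - q^-1).
have X0 : 0 <= X by exact: powR_ge0.
have gX : circle_norm q' g = X%:E.
  have gJ : \int[arc]_t (cabs (g (expi t)) `^ q') = J.
    apply: eq_Rintegral => t _; rewrite cabs_phase// -powRrM; congr (_ `^ _).
    by rewrite q'E mulrC divfK// gt_eqF// subr_gt0.
  by rewrite (circle_normE _ g q' bg q'0) gJ qi.
have GX : (hardy_norm p (riesz g) <= X%:E)%E.
  by rewrite -gX; exact: riesz_dual.
have [eg [L gL]] := riesz_expansion_bounded _ g bg.
(* The extended-real estimate (i) for [riesz g] becomes a real bound on partial sums, the form
   needed for the finite Cauchy-Schwarz inequality. *)
have gsum N : \sum_(0 <= n < N) cabs (fourier g n) ^+ 2 / c_coef (q / 2) n <=
  X ^+ 2.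
  have gh : hardy_space p (riesz g).
    by split; [exists (fourier g)|rewrite (le_lt_trans GX)// ltry].
  have := le_trans (coef_ineq _ p1 p2 _ _ gh eg) GX.
  have -> : 2 / p = q / 2 by rewrite /p; field; rewrite gt_eqF.
  set S := (X in sqrte X) => SX.
  have t0 n : (0 <= (cabs (fourier g n) ^+ 2 / c_coef (q / 2) n)%:E)%E.
    by rewrite lee_fin divr_ge0 ?sqr_ge0// ltW.
  have S0 : (0 <= S)%E by apply: nneseries_ge0 => n _ _.
  have SX2 : (S <= (X ^+ 2)%:E)%E.
    by rewrite -lee_sqrt ?lee_fin ?sqr_ge0//= sqrtr_sqr ger0_norm.
  rewrite -lee_fin (le_trans _ SX2)// -sumEFin.
  by apply: nneseries_lim_ge => n _ _.
have JX : J <= X * Num.sqrt B.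
  have /ccvg_Re JE := pairing_cvg _ _ _ _ s fa aK (ltW s0) s1 g bg.
  have -> : J = complex.Re
    (cint (fun t => f (s%:C%C * expi t) * (g (expi t))^*%C)).
    by apply: eq_Rintegral => t _; rewrite mul_phase.
  apply: (cvgr_to_le JE); near=> N.
  apply: (le_trans (ler_norm _)); apply: (le_trans (Re_le_cabs _ _)).
  apply: (le_trans (cabs_sum _ _ _ _)).
  apply: (@le_trans _ _ (\sum_(0 <= n < N) cabs (a n) * cabs (fourier g n))).
    (* The dilation factor [s ^+ n] is at most 1 and is dropped, so the bound is uniform in the
       radius. *)
    apply: ler_sum => n _; rewrite !cabsM cabsJ cabs_real.
    rewrite ger0_norm ?exprn_ge0 ?(ltW s0)// ler_wpM2r ?cabs_ge0//.
    by rewrite ler_piMr ?cabs_ge0// exprn_ile1// ltW.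
  apply: (le_trans (cauchy_schwarz_sum _ _ _ _ _ c0)).
  rewrite mulrC ler_pM ?sqrtr_ge0//.
    by rewrite -[leRHS]ger0_norm// -sqrtr_sqr ler_sqrt ?sqr_ge0.
  by rewrite ler_sqrt// (le_trans _ (aB 0%N))// big_nil.
have -> : circle_norm q (fun z => f (s%:C%C * z)) = (J `^ q^-1)%:E.
  exact: circle_normE.
rewrite lee_fin; apply: powR_absorb => //; rewrite ?sqrtr_ge0 ?invr_gt0//.
Unshelve. all: by end_near. Qed.

End half_range.

(** * Squares of power series *)

(** Both sides run over the pairs with [j + m < N], by diagonals and by rows. *)
Lemma sum_triangle (A : comPzRingType) (w : nat -> A) N :
  \sum_(0 <= n < N) \sum_(0 <= j < n.+1) w j * w (n - j)%N =
  \sum_(0 <= j < N) w j * \sum_(0 <= m < N - j) w m.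
Proof.
elim: N => [|N IH]; first by rewrite !big_nil.
rewrite big_nat_recr//= IH.
transitivity (\sum_(0 <= j < N.+1)
    (w j * \sum_(0 <= m < N - j) w m + w j * w (N - j)%N)).
  by rewrite big_split/=; congr (_ + _);
    rewrite big_nat_recr//= subnn big_nil mulr0 addr0.
apply: eq_big_nat => j /andP[_ jN].
by rewrite subSn// big_nat_recr//= mulrDr.
Qed.

(** With [m = n - j], [(j + 1) (m + 1) >= n + 1], so each of the [n + 1] terms is at most
    [1/(n + 1)]. The numerator [1 ^+ 2] matches [cauchy_schwarz_sum] with constant second factor
    1. *)
Lemma sum_conv_inv_le1 (R : realType) n :
  \sum_(0 <= j < n.+1) (1 : R) ^+ 2 / (j.+1%:R * (n - j).+1%:R) <= 1.
Proof.
apply: (@le_trans _ _ (\sum_(0 <= j < n.+1) (n.+1%:R)^-1)).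
  apply: ler_sum_nat => j /andP[_ jn].
  rewrite expr1n div1r lef_pV2 ?posrE ?mulr_gt0 ?ltr0n//.
  rewrite -natrM ler_nat -{1}(@subnKC j n)// mulnS mulSn; nia.
by rewrite sumr_const_nat subn0 -[_^-1 *+ _]mulr_natr mulVf// pnatr_eq0.
Qed.

Section cauchy_square.
Variable R : realType.
Implicit Types (f : R[i] -> R[i]) (a : nat -> R[i]).

Definition conv_square a n : R[i] := \sum_(0 <= j < n.+1) a j * a (n - j)%N.

Lemma power_series_conv_square a z N : power_series (conv_square a) z N =
  \sum_(0 <= j < N) a j * z ^+ j * power_series a z (N - j)%N.
Proof.
rewrite /power_series /series/= -(sum_triangle _ (fun n => a n * z ^+ n)).
apply: eq_bigr => n _; rewrite mulr_suml; apply: eq_big_nat => j /andP[_ jn].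
by rewrite mulrACA -exprD subnKC.
Qed.

Lemma disc_expansion_sqr f a (K : R) : disc_expansion f a ->
  (forall n, cabs (a n) <= K) ->
  disc_expansion (fun z => f z ^+ 2) (conv_square a).
Proof.
move=> fa aK z z1.
(* Any [r] strictly between [s] and 1 would do. A tail estimate at radius [s] would leave [N] terms
   of size [s^N]; at radius [r] the [j]-th term is of size [r^N (s/r)^j], summable in [j]. Moreover
   [r] is nonzero even for [z = 0]. *)
pose s := cabs z; pose r := (1 + s) / 2.
have s0 : 0 <= s by exact: cabs_ge0.
have s1 : s < 1 by [].
have sr : s < r by rewrite /r; lra.
have r1 : r < 1 by rewrite /r; lra.
have r0 : 0 < r by exact: le_lt_trans sr.
have K0 : 0 <= K by rewrite (le_trans (cabs_ge0 _ (a 0)))// aK.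
have fz := fa z z1.
pose P N := power_series a z N.
have Pb N : cabs (P N) <= K / (1 - s).
  have := power_series_cauchy _ _ K s s0 s1 aK z 0 N (lexx _) (leq0n _).
  by rewrite /P /power_series /series/= [X in _ - X]big_geq// subr0 expr0 mulr1.
have fb : cabs (f z) <= K / (1 - s).
  exact: (power_series_bound _ _ K s s0 s1 aK z (f z) (lexx _) fz).
pose t1 N := K * s ^+ N / (1 - s) * (K / (1 - s) + K / (1 - s)).
have Pt1 N : cabs (P N ^+ 2 - f z ^+ 2) <= t1 N.
  rewrite subr_sqr cabsM ler_pM ?cabs_ge0//.
    rewrite cabs_distC.
    exact: (power_series_tail _ _ K s s0 s1 aK z (f z) N (lexx _) fz).
  by rewrite (le_trans (cabsD _ _ _))// lerD.
pose t2 N := K * r ^+ N / (1 - r) * (K / (1 - s / r)).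
have sr0 : 0 <= s / r by rewrite divr_ge0// ltW.
have sr1 : 0 < 1 - s / r by rewrite subr_gt0 ltr_pdivrMr// mul1r.
(* The square of the partial sum and the partial sum of the Cauchy product differ by the products of
   index [j + m >= N]. *)
have Pt2 N : cabs (P N ^+ 2 - power_series (conv_square a) z N) <= t2 N.
  have -> : P N ^+ 2 - power_series (conv_square a) z N =
      \sum_(0 <= j < N) a j * z ^+ j * (P N - P (N - j)%N).
    rewrite power_series_conv_square expr2 {1}/P /power_series /series/=.
    by rewrite mulr_suml -sumrB; apply: eq_bigr => j _; rewrite mulrBr.
  apply: (le_trans (cabs_sum _ _ _ _)).
  apply: (@le_trans _ _ (\sum_(0 <= j < N) K * r ^+ N / (1 - r) *
    (K * (s / r) ^+ j))).
    apply: ler_sum_nat => j /andP[_ jN].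
    have := power_series_cauchy _ _ K r (ltW r0) r1 aK z (N - j) N (ltW sr)
      (leq_subr _ _).
    have := ler_pM (cabs_ge0 _ (a j)) (exprn_ge0 j s0) (aK j) (lexx _).
    rewrite -cabsX -cabsM => ajz PP; rewrite cabsM.
    apply: (le_trans (ler_pM (cabs_ge0 _ _) (cabs_ge0 _ _) ajz PP)).
    have rN : r ^+ N = r ^+ (N - j) * r ^+ j by rewrite -exprD subnK// ltnW.
    rewrite ?cabsX -/s rN [(s / r) ^+ j]expr_div_n le_eqVlt; apply/orP; left;
      apply/eqP; field.
    by rewrite expf_neq0 ?gt_eqF// subr_gt0.
  rewrite -mulr_sumr -mulr_sumr ler_wpM2l//.
    by rewrite divr_ge0 ?subr_ge0 ?(ltW r1)// mulr_ge0// exprn_ge0// ltW.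
  rewrite ler_wpM2l//.
  rewrite -[X in X <= _]/(series (fun j => (s / r) ^+ j) N).
  have -> : (fun j => (s / r) ^+ j) = geometric 1 (s / r).
    by apply/funext => j; rewrite /geometric/= mul1r.
  rewrite geometric_seriesE; last by rewrite lt_eqF// -subr_gt0.
  by rewrite /= mul1r ler_pdivrMr// mulVf ?gt_eqF// lerBlDr lerDl exprn_ge0.
apply: (ccvg_bound _ _ _ (fun N => t1 N + t2 N)) => [N|].
  rewrite -(subrKA (P N ^+ 2)) addrC (le_trans (cabsD _ _ _))// lerD//.
  by rewrite cabs_distC.
rewrite -[X in _ --> X]addr0; apply: cvgD.
  by rewrite -[X in _ --> X](mul0r (K / (1 - s) + K / (1 - s)));
    apply: cvgMr_tmp;
    exact: tail_cvg0 s0 s1.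
by rewrite -[X in _ --> X](mul0r (K / (1 - s / r))); apply: cvgMr_tmp;
  exact: tail_cvg0 (ltW r0) r1.
Qed.

Lemma conv_square_bound a (b B : R) : 1 <= b ->
  (forall N, \sum_(0 <= n < N) cabs (a n) ^+ 2 * c_coef (2 * b) n <= B) ->
  forall N, \sum_(0 <= n < N) cabs (conv_square a n) ^+ 2 * c_coef b n <=
    B ^+ 2.
Proof.
move=> b1 aB N; pose X n := cabs (a n) ^+ 2 * c_coef (2 * b) n.
have c0 x n : 1 <= x -> 0 <= c_coef x n :> R.
  by move=> x1; exact: le_trans ler01 (c_coef_ge1 _ x n x1).
have X0 n : 0 <= X n by rewrite mulr_ge0 ?sqr_ge0// c0//; lra.
have SX0 n : 0 <= \sum_(0 <= k < n) X k by exact: sumr_ge0.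
apply: (@le_trans _ _ (\sum_(0 <= n < N) \sum_(0 <= j < n.+1) X j *
  X (n - j)%N)).
  (* Weights for Cauchy-Schwarz within a single coefficient: their reciprocals sum to at most 1, and
     [c_coef_conv] absorbs the weights themselves. *)
  apply: ler_sum => n _; pose w j : R := j.+1%:R * (n - j).+1%:R.
  have w0 j : 0 < w j by rewrite mulr_gt0 ?ltr0n.
  pose S := \sum_(0 <= j < n.+1) (cabs (a j) * cabs (a (n - j)%N)) ^+ 2 * w j.
  have S0 : 0 <= S by apply: sumr_ge0 => j _; rewrite mulr_ge0 ?sqr_ge0// ltW.
  have bS : cabs (conv_square a n) ^+ 2 <= S.
    rewrite -[leRHS](sqr_sqrtr S0) lerXn2r ?nnegrE ?cabs_ge0 ?sqrtr_ge0//.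
    apply: (le_trans (cabs_sum _ _ _ _));
      under eq_bigr do rewrite cabsM -[cabs _ * _]mulr1.
    apply: (le_trans (cauchy_schwarz_sum _ _ _ (fun=> 1) _ w0)).
    by rewrite ler_piMr ?sqrtr_ge0// -[leRHS]sqrtr1 ler_sqrt// sum_conv_inv_le1.
  apply: (le_trans (ler_wpM2r (c0 _ _ b1) bS)).
  rewrite mulr_suml; apply: ler_sum_nat => j /andP[_ jn].
  have := c_coef_conv _ b j (n - j) b1; rewrite subnKC//.
  move=> /(ler_wpM2l (mulr_ge0 (sqr_ge0 (cabs (a j))) (sqr_ge0
    (cabs (a (n - j)%N))))) h.
  apply: etrans h.
  by congr (_ <= _); rewrite /X /w; ring.
rewrite sum_triangle expr2.
apply: (@le_trans _ _ (\sum_(0 <= j < N) X j * B)).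
  by apply: ler_sum => j _; rewrite ler_wpM2l//; exact: aB.
by rewrite -mulr_suml ler_wpM2r ?(le_trans (SX0 0%N) (aB 0%N))//; exact: aB.
Qed.

End cauchy_square.

(** * Parseval's identity and the doubling of the exponent *)

Lemma arc_int_FTC (R : realType) (u U : R -> R) : (forall t, 0 <= u t) ->
  continuous u -> (forall t : R, is_derive t (1 : R) U (u t)) ->
  \int[arc]_t u t = (U (2 * pi) - U 0) / (2 * pi).
Proof.
move=> u0 cu dU; rewrite /Rintegral integral_uniform//; last first.
  by apply/measurable_EFinP; exact: continuous_measurable_fun.
have cU : continuous U.
  by move=> t; apply: differentiable_continuous; apply/derivable1_diffP;
    case: (dU t).
rewrite (@continuous_FTC2 _ u U)//.
- by rewrite -EFinB -EFinM /= subr0 mulrC.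
- exact: pi2_gt0.
- exact: continuous_subspaceT.
- split.
  + by move=> t _; case: (dU t).
  + by apply: cvg_at_right_filter; exact: cU.
  + by apply: cvg_at_left_filter; exact: cU.
- by move=> t _; rewrite derive1E; case: (dU t).
Qed.

Lemma expi_2pi_int (R : realType) n m : expi ((n%:R - m%:R) * (2 * pi) : R) = 1.
Proof.
have e2 : expi (2 * pi : R) = 1.
  by rewrite /expi mulr_natl cos2pi sin2pi.
by rewrite mulrBl expiD expiN -(expiX _ (2 * pi) n)
  -(expiX _ (2 * pi) m) e2 !expr1n mul1r conjc1.
Qed.

Lemma cint_expi (R : realType) n m : n != m ->
  cint (fun t : R => expi ((n%:R - m%:R) * t)) = 0.
Proof.
move=> nm; pose k : R := n%:R - m%:R.
have k0 : k != 0 by rewrite subr_eq0 eqr_nat.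
have pi0 : 2 * pi != 0 :> R by rewrite gt_eqF// pi2_gt0.
have [ek1 ek2] : cos (k * (2 * pi)) = 1 /\ sin (k * (2 * pi)) = 0.
  by have := expi_2pi_int R n m; rewrite /expi => -[].
have [bc bs] := cbmeas_expi R k.
have ck : continuous (fun t : R => k * t) by move=> t; exact: mulrl_continuous.
(* Adding 1 makes cosine and sine nonnegative, as [arc_int_FTC] requires. *)
have shift (u : R -> R) : bmeas u -> \int[arc]_t (1 + u t) = 1 ->
  \int[arc]_t u t = 0.
  move=> bu; rewrite RintegralD//; last 2 first.
    by apply: bmeas_integrable; exact: bmeas_cst.
    exact: bmeas_integrable.
  by rewrite arc_int_cst => h; apply: (addrI 1); rewrite h addr0.
rewrite /cint; congr (_ +i* _)%C; apply: shift => //=.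
- have d t : is_derive (t : R) (1 : R)
    (fun t => t + k^-1 * sin (k * t)) (1 + cos (k * t)).
    have dk : is_derive t (1 : R) (fun t => k * t) k.
      by apply: is_derive_eq; rewrite /= [LHS]mulr1.
    have ds := @is_derive1_comp _ sin (fun t => k * t) t _ _ _ dk.
    apply: is_derive_eq.
    by rewrite /GRing.scale/= mulrCA mulVf// mulr1.
  rewrite (arc_int_FTC _ _ _ _ _ d).
  + by rewrite ek2 !mulr0 sin0 mulr0 !addr0 subr0 divff.
  + by move=> t; have := cos_geN1 (k * t); lra.
  + move=> t; apply: cvgD; first exact: cvg_cst.
    by apply: continuous_comp; [exact: ck|exact: continuous_cos].
- have d t : is_derive (t : R) (1 : R)
    (fun t => t - k^-1 * cos (k * t)) (1 + sin (k * t)).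
    have dk : is_derive t (1 : R) (fun t => k * t) k.
      by apply: is_derive_eq; rewrite /= [LHS]mulr1.
    have ds := @is_derive1_comp _ cos (fun t => k * t) t _ _ _ dk.
    apply: is_derive_eq.
    by rewrite /GRing.scale/= mulNr mulrN opprK mulrCA mulVf// mulr1.
  rewrite (arc_int_FTC _ _ _ _ _ d).
  + by rewrite ek1 !mulr0 cos0 mulr1 sub0r opprK subrK divff.
  + by move=> t; have := sin_geN1 (k * t); lra.
  + move=> t; apply: cvgD; first exact: cvg_cst.
    by apply: continuous_comp; [exact: ck|exact: continuous_sin].
Qed.

Section expansion.
Variable R : realType.
Implicit Types (f : R[i] -> R[i]) (a : nat -> R[i]).

Lemma fourier_monomial n m :
  fourier (fun z : R[i] => z ^+ n) m = (n == m)%:R.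
Proof.
have -> : fourier (fun z : R[i] => z ^+ n) m =
    cint (fun t : R => expi ((n%:R - m%:R) * t)).
  by rewrite /fourier /cint; congr (_ +i* _)%C; apply: eq_Rintegral => t _;
    rewrite mulrBl expiD expiX.
have [->|nm] := eqVneq n m; last exact: cint_expi.
rewrite subrr (_ : (fun t : R => _) = fun=> 1); last first.
  by apply/funext => t; rewrite mul0r /expi cos0 sin0.
by rewrite /cint !arc_int_cst.
Qed.

Lemma fourier_dilate f a (K s : R) n : disc_expansion f a ->
  (forall n, cabs (a n) <= K) -> 0 <= s -> s < 1 ->
  fourier (fun z => f (s%:C%C * z)) n = a n * (s ^+ n)%:C%C.
Proof.
move=> fa aK s0 s1.
have bn : cbmeas (fun t : R => (fun z : R[i] => z ^+ n) (expi t)) by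
  exact: cbmeas_expiX.
have lim1 := pairing_cvg _ _ _ _ s fa aK s0 s1 (fun z => z ^+ n) bn.
have -> : fourier (fun z => f (s%:C%C * z)) n =
    cint (fun t => f (s%:C%C * expi t) * ((expi t ^+ n)^*)%C).
  by rewrite /fourier /cint; congr (_ +i* _)%C; apply: eq_Rintegral => t _;
    rewrite expiX expiN.
apply: (ccvg_unique _ _ _ _ lim1).
apply: (@cvg_trans _ (cst (a n * (s ^+ n)%:C%C : R[i]^o) @ \oo)); last
  exact: cvg_cst.
have termE m : a m * (s ^+ m)%:C%C * (fourier (fun z => z ^+ n) m)^*%C =
    if n == m then a n * (s ^+ n)%:C%C else 0.
  rewrite fourier_monomial; case: eqVneq => [->|_];
    first by rewrite conjc1 mulr1.
  by rewrite conjc0 mulr0.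
(* Pairing with a monomial keeps one term, so the partial sums are constant once [N > n]. *)
apply: near_eq_cvg; near=> N.
have nN : (n < N)%N by near: N; exact: nbhs_infty_gt.
rewrite /cst; under [RHS]eq_bigr do rewrite termE.
rewrite (@big_cat_nat _ _ _ n.+1 0 N)//= big_nat_recr//= eqxx.
rewrite big_nat_cond big1 => [|m /andP[/andP[_ mn] _]]; last by rewrite gtn_eqF.
rewrite [X in _ + _ + X]big_nat_cond [X in _ + _ + X]big1 ?add0r ?addr0//.
by move=> m /andP[/andP[nm _] _]; rewrite ltn_eqF.
Unshelve. all: by end_near. Qed.

(** The dilate is paired with itself; the resulting factors [s ^+ n] are at most 1, and only this
    half of Parseval is needed. *)
Lemma expansion_ineq2 f a (B : R) : disc_expansion f a ->
  (forall N, \sum_(0 <= n < N) cabs (a n) ^+ 2 <= B) ->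
  (hardy_norm 2 f <= (Num.sqrt B)%:E)%E.
Proof.
move=> fa aB; apply: hardy_norm_le => s /andP[s0 s1].
have aK n : cabs (a n) <= Num.sqrt B.
  apply: (coef_le_sqrt _ a (fun=> 1)) => // N.
  by under eq_bigr do rewrite mulr1.
pose h z := f (s%:C%C * z).
have bh : cbmeas (fun t => h (expi t)) by apply: cbmeas_disc fa aK _ s1;
  exact: ltW.
have fh n : fourier h n = a n * (s ^+ n)%:C%C.
  by apply: fourier_dilate fa aK _ s1; exact: ltW.
have /ccvg_Re lim1 := pairing_cvg _ _ _ _ s fa aK (ltW s0) s1 h bh.
rewrite (circle_normE _ h 2 bh)// lee_fin powR12_sqrt; last first.
  by apply: Rintegral_ge0 => t _; exact: powR_ge0.
apply: ler_wsqrtr.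
have -> : \int[arc]_t (cabs (h (expi t)) `^ 2) =
    complex.Re (cint (fun t => f (s%:C%C * expi t) * (h (expi t))^*%C)).
  by apply: eq_Rintegral => t _; rewrite mulcJ/= powR_mulrn ?cabs_ge0.
apply: (cvgr_to_le lim1); near=> N.
apply: le_trans (aB N); apply: (le_trans (ler_norm _)).
apply: (le_trans (Re_le_cabs _ _)); apply: (le_trans (cabs_sum _ _ _ _)).
apply: ler_sum => n _; rewrite fh mulcJ cabs_real ger0_norm ?sqr_ge0//.
rewrite cabsM cabs_real ger0_norm ?exprn_ge0 ?(ltW s0)//.
rewrite lerXn2r ?nnegrE ?mulr_ge0 ?cabs_ge0 ?exprn_ge0 ?(ltW s0)//.
by rewrite ler_piMr ?cabs_ge0// exprn_ile1// ltW.
Unshelve. all: by end_near. Qed.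

(** On each circle the [L^q] norm of [f], squared, is the [L^(q/2)] norm of [f^2]. *)
Lemma hardy_norm_sqr_le f (q B : R) : 0 < q -> 0 <= B ->
  (forall s, 0 < s < 1 -> cbmeas (fun t => f (s%:C%C * expi t))) ->
  (hardy_norm (q / 2) (fun z => (f z ^+ 2)%R) <= B%:E)%E ->
  (hardy_norm q f <= (Num.sqrt B)%:E)%E.
Proof.
move=> q0 B0 bf fB; apply: hardy_norm_le => s s01.
have b1 := bf s s01.
have b2 : cbmeas (fun t => f (s%:C%C * expi t) ^+ 2).
  by under eq_fun do rewrite expr2; exact: cbmeasM.
have q20 : 0 < q / 2 by rewrite divr_gt0.
rewrite (circle_normE _ (fun z => f (s%:C%C * z)) q b1 q0) lee_fin.
have := le_trans (circle_norm_le_hardy _ _ _ s s01) fB.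
rewrite (circle_normE _ (fun z => f (s%:C%C * z) ^+ 2) (q / 2) b2 q20) lee_fin.
have -> : \int[arc]_t (cabs (f (s%:C%C * expi t) ^+ 2) `^ (q / 2)) =
    \int[arc]_t (cabs (f (s%:C%C * expi t)) `^ q).
  apply: eq_Rintegral => t _; rewrite cabsX -powR_mulrn ?cabs_ge0// -powRrM.
  by congr (_ `^ _); field.
set Y := Rintegral _ _ _ => YB.
rewrite -[leLHS]ger0_norm ?powR_ge0// -sqrtr_sqr; apply: ler_wsqrtr.
apply: le_trans YB; rewrite -powR_mulrn ?powR_ge0// -powRrM.
by rewrite invf_div mulrC.
Qed.

Hypothesis coef_ineq : forall p : R, 1 < p -> p < 2 ->
  forall (f : R[i] -> R[i]) (a : nat -> R[i]),
    hardy_space p f -> disc_expansion f a ->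
    (sqrte (\sum_(0 <= n <oo) (cabs (a n) ^+ 2 / c_coef (2 / p) n)%:E)
      <= hardy_norm p f)%E.
Hypothesis riesz_contr : forall r : R, 2 < r ->
  forall f : R[i] -> R[i], circle_Lspace r f ->
    (hardy_norm (4 * (1 - 1 / r)) (riesz f) <= circle_norm r f)%E.

(** [k] bounds the number of halvings of [q] before it falls below 4. The endpoint 2 is included
    because halving 4 produces it. *)
Lemma expansion_ineq (k : nat) (q B : R) f a : 2 <= q -> q < 4 * 2 ^+ k ->
  disc_expansion f a ->
  (forall N, \sum_(0 <= n < N) cabs (a n) ^+ 2 * c_coef (q / 2) n <= B) ->
  (hardy_norm q f <= (Num.sqrt B)%:E)%E.
Proof.
elim: k q B f a => [|k IH] q B f a q2 qk fa aB.
  move: q2; rewrite le_eqVlt => /predU1P[q2|q2].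
    rewrite -q2; apply: expansion_ineq2 fa _ => N.
    move: (aB N); rewrite -q2 divff//.
    by under eq_bigr do rewrite c_coef1 mulr1.
  apply: (expansion_ineq_lt4 _ riesz_contr coef_ineq) q2 _ fa aB.
  by rewrite expr0 mulr1 in qk.
have [q4|q4] := ltP q 4.
  by apply: IH q2 _ fa aB;
    rewrite (lt_le_trans q4)// ler_peMr// exprn_ege1// ler1n.
have B0 : 0 <= B by rewrite (le_trans _ (aB 0%N))// big_nil.
have q21 : 1 <= q / 2 by lra.
have aK := coef_le_sqrt _ a (c_coef (q / 2)) B (fun n =>
  c_coef_ge1 _ _ n q21) aB.
apply: hardy_norm_sqr_le => //; first by lra.
  by move=> s /andP[s0 s1]; apply: cbmeas_disc fa aK _ s1; exact: ltW.
(* [B] becomes the root of [B ^+ 2], the bound that [conv_square_bound] gives for the coefficients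
   of [f^2]. *)
rewrite -[B in leRHS]ger0_norm// -sqrtr_sqr.
apply: (IH (q / 2) _ _ (conv_square R a)).
- by lra.
- by move: qk; rewrite exprS; lra.
- exact: disc_expansion_sqr fa aK.
- apply: conv_square_bound; first by lra.
  by move=> N; rewrite mulrC divfK.
Qed.

End expansion.

Theorem theorem10 (R : realType)
  (coef_ineq : forall p : R, 1 < p -> p < 2 ->
    forall (f : R[i] -> R[i]) (a : nat -> R[i]),
      hardy_space p f -> disc_expansion f a ->
      (sqrte (\sum_(0 <= n <oo) (cabs (a n) ^+ 2 / c_coef (2 / p) n)%:E)
        <= hardy_norm p f)%E)
  (riesz_contr : forall r : R, 2 < r ->
    forall f : R[i] -> R[i], circle_Lspace r f ->
      (hardy_norm (4 * (1 - 1 / r)) (riesz f) <= circle_norm r f)%E) :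
  forall q : R, 2 < q ->
    forall (f : R[i] -> R[i]) (a : nat -> R[i]),
      disc_expansion f a ->
      (\sum_(0 <= n <oo) (cabs (a n) ^+ 2 * c_coef (q / 2) n)%:E < +oo)%E ->
      (hardy_norm q f <=
        sqrte (\sum_(0 <= n <oo) (cabs (a n) ^+ 2 * c_coef (q / 2) n)%:E))%E.
Proof.
move=> q q2 f a fa; set S := (X in (X < _)%E) => Sfin.
have t0 n : (0 <= (cabs (a n) ^+ 2 * c_coef (q / 2) n)%:E)%E.
  rewrite lee_fin mulr_ge0 ?sqr_ge0// (le_trans ler01)// c_coef_ge1//; lra.
have S0 : (0 <= S)%E by apply: nneseries_ge0 => n _ _.
have SE : S = (fine S)%:E by rewrite fineK// ge0_fin_numE.
have [k qk] : exists k : nat, q < 4 * 2 ^+ k.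
  (* [q] is below the integer [n = truncn q + 1], and [n < 2^n]. *)
  exists (Num.truncn q).+1; apply: (lt_trans (truncnS_gt q)).
  rewrite -natrX -natrM ltr_nat (leq_trans (ltn_expl _ (leqnn 2)))//.
  by rewrite leq_pmull.
rewrite -/S SE; apply: (expansion_ineq _ coef_ineq riesz_contr k) qk fa _;
  first exact: ltW.
move=> N; rewrite -lee_fin -SE -sumEFin.
by apply: nneseries_lim_ge => n _ _.
Qed.
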